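(* The intrinsic metric $\hat d_E$ associated to the erosion distance is the bottleneck distance $d_B$; that is, $\hat d_E(Y,Y')=d_B(Y,Y')$ for all $Y,Y'\in\mathsf{PDgm}$.
   Context: Let $\mathbb{R}^2_<=\{(b,d)\in\mathbb{R}^2: b<d\}$. A persistence diagram is a finite multiset $Y=\{(b_i,d_i)\}_{i=1}^N$ of points of $\mathbb{R}^2_<$; $\mathsf{PDgm}$ is the set of all of them. For $b\le d$, $\mathrm{rank}[Y](b,d)$ is the number (with multiplicity) of $(b_i,d_i)\in Y$ with $b_i\le b\le d<d_i$. The erosion distance $d_E(Y,Y')$ is the infimum of all $\varepsilon\ge0$ such that, for all $b\le d$, $\mathrm{rank}[Y](b-\varepsilon,d+\varepsilon)\le\mathrm{rank}[Y'](b,d)$ and $\mathrm{rank}[Y'](b-\varepsilon,d+\varepsilon)\le\mathrm{rank}[Y](b,d)$. The bottleneck distance is $$d_B(Y,Y')=\min_{\phi:S\to S'}\max\left\{\max_{(b,d)\in S}d_\infty((b,d),\phi(b,d)),\ \max_{(b,d)\in Y\setminus S}\tfrac{d-b}{2},\ \max_{(b',d')\in Y'\setminus S'}\tfrac{d'-b'}{2}\right\},$$ the minimum being over bijections $\phi$ between sub-multisets $S\subseteq Y$ and $S'\subseteq Y'$, with $d_\infty((b,d),(b',d'))=\max\{|b-b'|,|d-d'|\}$ and maxima over empty sets equal to $0$. For a metric space $(X,d)$ and a continuous path $\alpha:[0,1]\to X$, $\mathrm{len}_d(\alpha)=\sup\{\sum_i d(\alpha(t_i),\alpha(t_{i+1})):0=t_0<t_1<\dots<t_{n+1}=1\}$.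 The intrinsic metric associated to $d$ is $\hat d(x,x')=\inf\{\mathrm{len}_d(\alpha):\alpha(0)=x,\ \alpha(1)=x'\}$, the infimum being over continuous paths $\alpha:[0,1]\to X$. *)

(* Defs.v *)
From HB Require Import structures.
From mathcomp Require Import all_boot all_order all_algebra.
From mathcomp Require Import finmap multiset.
From mathcomp Require Import all_classical all_reals all_analysis.
From mathcomp Require Import lra.

Set Implicit Arguments.
Unset Strict Implicit.
Unset Printing Implicit Defensive.

Import Order.TTheory GRing.Theory Num.Theory.
Import numFieldNormedType.Exports.

Local Open Scope classical_set_scope.
Local Open Scope ring_scope.

Definition half_plane (R : realType) := {p : R * R | p.1 < p.2}.

HB.instance Definition _ (R : realType) := Choice.on (half_plane R).

Definition PDgm (R : realType) := multiset (half_plane R).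

HB.instance Definition _ (R : realType) := Choice.on (PDgm R).

Section PersistenceDiagrams.
Variable R : realType.
Implicit Types (Y : PDgm R) (p q : half_plane R) (b d e : R).

Definition birth p : R := (val p).1.
Definition death p : R := (val p).2.

(* The points of a diagram, listed with multiplicity. *)
Definition points Y : seq (half_plane R) := enum_mset Y.

(* Only meaningful for b <= d. *)
Definition rank Y b d : nat :=
  count (fun p => (birth p <= b) && (d < death p)) (points Y).

Definition eroded Y Y' e : Prop :=
  0 <= e /\ forall b d, b <= d ->
    (rank Y (b - e) (d + e) <= rank Y' b d)%N /\
    (rank Y' (b - e) (d + e) <= rank Y b d)%N.

Definition erosion_dist Y Y' : R := inf [set e | eroded Y Y' e].

Definition dinfty p q : R :=
  Num.max `|birth p - birth q| `|death p - death q|.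

(* Multiset elements are identified with positions in the enumeration, so that
   repeated points are distinct elements.  A bijection between sub-multisets S
   of Y and S' of Y' is a partial map on positions that is injective on its
   domain S; its codomain is S'. *)
Definition dgm_index Y := 'I_(size (points Y)).
Definition dgm_point Y (i : dgm_index Y) : half_plane R := tnth (in_tuple (points Y)) i.

Definition partial_map Y Y' := {ffun dgm_index Y -> option (dgm_index Y')}.

Definition is_matching Y Y' (phi : partial_map Y Y') : bool :=
  dinjectiveb phi [pred i | isSome (phi i)].

Definition matching_cost Y Y' (phi : partial_map Y Y') : R :=
  Num.max
    (\big[Num.max/0]_(ij : dgm_index Y * dgm_index Y' | phi ij.1 == Some ij.2)
        dinfty (dgm_point ij.1) (dgm_point ij.2))
    (Num.max
      (\big[Num.max/0]_(i : dgm_index Y | phi i == None)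
          ((death (dgm_point i) - birth (dgm_point i)) / 2))
      (\big[Num.max/0]_(j : dgm_index Y' | Some j \notin codom phi)
          ((death (dgm_point j) - birth (dgm_point j)) / 2))).

(* The default value of the minimum is the cost of the empty matching, which is
   itself one of the matchings the minimum ranges over. *)
Definition bottleneck_dist Y Y' : R :=
  \big[Num.min/matching_cost ([ffun=> None] : partial_map Y Y')]_(
     phi : partial_map Y Y' | is_matching phi) matching_cost phi.

End PersistenceDiagrams.

Section IntrinsicMetric.
Context {R : realType} {X : metricType R}.
Implicit Types (x y : X) (f : R -> X).

(* The subdivision 0 = t_0 < t_1 < ... < t_(n+1) = 1 is 0 :: s. *)
Definition polygonal_length f (s : seq R) : R :=
  let F := f \o nth 1 (0 :: s) in
  \sum_(0 <= i < size s) mdist (F i) (F i.+1).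

Definition path_length f : \bar R :=
  ereal_sup [set (polygonal_length f s)%:E | s in itv_partition 0 1].

(* Paths are functions on R of which only the restriction to [0, 1] matters. *)
Definition intrinsic_dist x y : \bar R :=
  ereal_inf [set path_length f | f in
    [set f : R -> X | [/\ {within `[0, 1], continuous f}, f 0 = x & f 1 = y]]].

End IntrinsicMetric.

Arguments intrinsic_dist {R} X x y.

Section ErosionMetric.
Variable R : realType.
Implicit Types (Y : PDgm R) (p q : half_plane R) (b d e : R).

Lemma eroded_sym Y Y' e : eroded Y Y' e -> eroded Y' Y e.
Proof. by move=> [e0 H]; split=> // b d /H[]. Qed.

Lemma eroded_trans Y2 Y1 Y3 e1 e2 :
  eroded Y1 Y2 e1 -> eroded Y2 Y3 e2 -> eroded Y1 Y3 (e1 + e2).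
Proof.
move=> [e10 H1] [e20 H2]; split=> [|b d bd]; first exact: addr_ge0.
have [H2l H2r] := H2 _ _ bd; have [H1l H1r] := H1 _ _ bd.
have bd2 : b - e2 <= d + e2 by lra.
have bd1 : b - e1 <= d + e1 by lra.
have [H1l' _] := H1 _ _ bd2; have [_ H2r'] := H2 _ _ bd1.
split.
  apply: leq_trans H2l; apply: leq_trans H1l'.
  by rewrite [e1 + e2]addrC opprD !addrA.
apply: leq_trans H1r; apply: leq_trans H2r'.
by rewrite opprD !addrA.
Qed.

Lemma erodedxx Y : eroded Y Y 0.
Proof. by split=> // b d bd; rewrite subr0 addr0. Qed.

Lemma eroded_neq0 Y Y' : exists e, eroded Y Y' e.
Proof.
pose l p := death p - birth p.
have l0 p : 0 <= l p by rewrite subr_ge0 ltW//; exact: (valP p).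
pose e := \sum_(p <- points Y ++ points Y') l p.
have e0 : 0 <= e by apply: sumr_ge0.
have le p : p \in points Y ++ points Y' -> l p <= e.
  by move=> pY; rewrite /e (big_rem p)//= lerDl sumr_ge0.
have r0 Z b d : {subset points Z <= points Y ++ points Y'} -> b <= d ->
    rank Z (b - e) (d + e) = 0%N.
  move=> ZY bd; apply/eqP; rewrite -leqn0 leqNgt -has_count; apply/hasPn.
  move=> p /ZY /le; rewrite /l => lp; apply/negP => /andP[]; lra.
exists e; split=> // b d bd.
by split; rewrite r0// => p pY; rewrite mem_cat pY ?orbT.
Qed.

Lemma eroded_has_inf Y Y' : has_inf [set e | eroded Y Y' e].
Proof. by split; [exact: eroded_neq0|exists 0 => e []]. Qed.

Lemma erosion_dist_ge0 Y Y' : 0 <= erosion_dist Y Y'.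
Proof. by apply: lb_le_inf; [exact: eroded_neq0|move=> e []]. Qed.

Lemma erosion_distxx Y : erosion_dist Y Y = 0.
Proof.
apply/eqP; rewrite eq_le erosion_dist_ge0 andbT.
by apply: ge_inf; [case: (eroded_has_inf Y Y)|exact: erodedxx].
Qed.

Lemma erosion_dist_sym Y Y' : erosion_dist Y Y' = erosion_dist Y' Y.
Proof. by congr inf; apply/seteqP; split=> e; exact: eroded_sym. Qed.

Lemma erosion_dist_triangle Y2 Y1 Y3 :
  erosion_dist Y1 Y3 <= erosion_dist Y1 Y2 + erosion_dist Y2 Y3.
Proof.
rewrite -lerBlDr; apply: lb_le_inf; first exact: eroded_neq0.
move=> e1 H1; rewrite lerBlDl -lerBlDr.
apply: lb_le_inf; first exact: eroded_neq0.
move=> e2 H2; rewrite lerBlDl; apply: ge_inf.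
  by case: (eroded_has_inf Y1 Y3).
exact: eroded_trans H1 H2.
Qed.

Let gap (s : seq R) (x : R) :
  exists2 h, 0 < h & forall y, y \in s -> x < y -> x + h < y.
Proof.
elim: s => [|a s [h h0 H]]; first by exists 1.
have [xa|ax] := ltP x a.
  exists (Num.min h ((a - x) / 2)).
    by rewrite lt_min h0/= divr_gt0 ?subr_gt0.
  move=> y; rewrite inE => /orP[/eqP ->|/H{}H] xy.
    have : Num.min h ((a - x) / 2) <= (a - x) / 2 by rewrite ge_min lexx orbT.
    by lra.
  have : Num.min h ((a - x) / 2) <= h by rewrite ge_min lexx.
  by move/H: xy; lra.
exists h => // y; rewrite inE => /orP[/eqP ->|]; last exact: H.
by rewrite ltNge ax.
Qed.

Let erosion_dist0_rank Y Y' b d :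
  erosion_dist Y Y' = 0 -> b <= d -> (rank Y b d <= rank Y' b d)%N.
Proof.
move=> YY' bd.
have [h1 h10 H1] := gap (map (@birth R) (points Y')) b.
have [h2 h20 H2] := gap (map (@death R) (points Y)) d.
pose h := Num.min h1 (h2 / 2).
have h0 : 0 < h by rewrite lt_min h10 divr_gt0.
have hh1 : h <= h1 by rewrite ge_min lexx.
have hh2 : h <= h2 / 2 by rewrite ge_min lexx orbT.
have [e [e0 He] ] := inf_adherent h0 (eroded_has_inf Y Y').
rewrite -/(erosion_dist _ _) YY' add0r => eh.
have bde : b + e <= d + e by rewrite lerD2r.
have [+ _] := He _ _ bde; rewrite addrK => Hr.
have -> : rank Y b d = rank Y b (d + e + e).
  apply: eq_in_count => p pY /=; congr andb; apply/idP/idP => [dp|]; last by lra.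
  have := H2 (death p) (map_f _ pY) dp; lra.
apply: (leq_trans Hr).
apply: (@leq_trans (rank Y' (b + e) d)).
  by apply: sub_count => p /andP[-> ]/=; lra.
rewrite /rank leq_eqVlt; apply/orP; left; apply/eqP.
apply: eq_in_count => p pY /=; congr andb; apply/idP/idP; last by lra.
have [//|bp] := leP (birth p) b.
have := H1 (birth p) (map_f _ pY) bp; lra.
Qed.

Let mult_rank Y p : exists2 h0, 0 < h0 & forall h, 0 < h <= h0 ->
  (rank Y (birth p) (death p - h) + rank Y (birth p - h) (death p) =
   rank Y (birth p - h) (death p - h) + rank Y (birth p) (death p)
   + count_mem p (points Y))%N.
Proof.
have [h1 h10 H1] := gap [seq - birth q | q <- points Y] (- birth p).
have [h2 h20 H2] := gap [seq - death q | q <- points Y] (- death p).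
exists (Num.min h1 h2); first by rewrite lt_min h10.
move=> h /andP[h0]; rewrite le_min => /andP[hh1 hh2].
have E1 q : q \in points Y -> (birth q <= birth p - h) = (birth q < birth p).
  move=> qY; apply/idP/idP => [|qp]; first by lra.
  have := H1 _ (map_f (fun q => - birth q) qY); rewrite ltrN2 => /(_ qp); lra.
have E2 q : q \in points Y -> (death p - h < death q) = (death p <= death q).
  move=> qY; apply/idP/idP => [|qp]; last by lra.
  rewrite leNgt => dp; apply/negP => qp.
  have := H2 _ (map_f (fun q => - death q) qY); rewrite ltrN2 => /(_ qp); lra.
have Ep q : (q == p) = (birth q == birth p) && (death q == death p).
  rewrite -val_eqE /birth /death.
  by case: (val q) (val p) => [? ?] [? ?].
rewrite /rank; elim: (points Y) E1 E2 => [|q s IH] E1 E2 //=.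
have {IH} := IH (fun r rs => E1 r (mem_behead (s := q :: s) rs))
                (fun r rs => E2 r (mem_behead (s := q :: s) rs)).
rewrite (E1 q (mem_head _ _)) (E2 q (mem_head _ _)) Ep.
set a := count _ _; set a' := count _ _; set c := count _ _.
set c' := count _ _; set m := count _ _ => IH.
have add (x y z t u : bool) : (x + y = z + t + u)%N ->
    ((x + a) + (y + a') = (z + c) + (t + c') + (u + m))%N.
  by move=> xyz; rewrite addnACA xyz IH addnACA; congr addn; exact: addnACA.
by apply: add; case: (ltgtP (birth q) (birth p)) => _;
   case: (ltgtP (death q) (death p)) => _.

Qed.

Lemma erosion_dist_eq0 Y Y' : erosion_dist Y Y' = 0 -> Y = Y'.
Proof.
move=> YY'.
have rE b d : b <= d -> rank Y b d = rank Y' b d.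
  move=> bd; apply/eqP; rewrite eqn_leq !erosion_dist0_rank//.
  by rewrite erosion_dist_sym.
apply/fsfunP => p.
have cE (Z : {mset half_plane R}%mset) : Z p = count_mem p (points Z) by rewrite count_mem_mset.
have [h1 h10 H1] := mult_rank Y p; have [h2 h20 H2] := mult_rank Y' p.
have l0 : 0 < death p - birth p by rewrite subr_gt0; exact: (valP p).
pose h := Num.min (Num.min h1 h2) (death p - birth p).
have h0 : 0 < h by rewrite !lt_min h10 h20.
have [hh1 hh2 hl] : [/\ h <= h1, h <= h2 & h <= death p - birth p].
  by rewrite /h !ge_min !lexx !orbT.
have := H1 h; have := H2 h; rewrite h0 hh1 hh2 => /(_ isT) e2 /(_ isT).
rewrite !rE; [|lra..]; rewrite e2 => /eqP; rewrite eqn_add2l => /eqP.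
by rewrite !cE => ->.
Qed.

End ErosionMetric.

(* The set PDgm equipped with the metric d_E. *)
Definition erosion_space (R : realType) := PDgm R.

HB.instance Definition _ (R : realType) := Choice.on (erosion_space R).

HB.instance Definition _ (R : realType) :=
  isMetric.Build R (erosion_space R) (@erosion_distxx R) (@erosion_dist_eq0 R)
    (@erosion_dist_sym R) (@erosion_dist_triangle R).

Lemma mdist_erosionE (R : realType) (Y Y' : erosion_space R) :
  mdist Y Y' = erosion_dist Y Y'.
Proof. by []. Qed.

(* Main.v *)
Require Import Defs.
From mathcomp Require Import all_boot all_order all_algebra.
From mathcomp Require Import finmap multiset.
From mathcomp Require Import all_classical all_reals all_analysis.
From mathcomp Require Import ring lra.

(** Write d_E and d_B for the erosion and the bottleneck distance.

    Upper bound.  An optimal matching is turned into the path that moves every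
    matched point along a straight line to its partner and every unmatched
    point along a straight line to or from the diagonal.  A point moved by at
    most x in both coordinates changes ranks only within erosion x, so this
    path is d_E-Lipschitz with constant d_B(Y,Y') ([matches_lerp_path]) and its
    length is at most d_B(Y,Y').

    Lower bound.  It is not true that d_E and d_B agree near a diagram: for
    Y = {(0,1)} and Y' = {(0,1-e),(1-3e,1+e)} with e small, d_E(Y,Y') = e while
    d_B(Y,Y') = 2e.  The failure only concerns points of small persistence: for
    every h > 0, all Y' close enough to Y admit a matching with Y that moves
    points by at most d_E(Y,Y') and leaves unmatched only points of
    half-persistence at most h ([erosion_local_matches]).  It comes from
    inclusion-exclusion on ranks: near Y, the number of points of Y' in a tight
    box around a point of Y is the multiplicity of that point, and a box
    containing a point of Y' far from the diagonal has to meet Y.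

    Such matchings are composed along a path from Y to Y'.  The displacements
    of matched points add up to a polygonal length L, but the tolerance h does
    not accumulate: a track dies or is born with half-persistence at most h
    and is then moved by at most L in total, so that each unmatched endpoint
    has half-persistence at most L + h ([matches_comp]).  A supremum argument
    on [0,1] reaches the end of the path ([path_matches]), whence
    d_B(Y,Y') <= L + h with L at most the length of the path. *)

Set Implicit Arguments.
Unset Strict Implicit.
Unset Printing Implicit Defensive.

Import Order.TTheory GRing.Theory Num.Theory.
Import numFieldNormedType.Exports.

(** * Matchings with two tolerances *)

Section Matchings.
Local Open Scope classical_set_scope.
Local Open Scope ring_scope.
Variable R : realType.
Implicit Types (Y : PDgm R) (p q : half_plane R) (c h : R).

Definition half_pers p : R := (death p - birth p) / 2.

Lemma birth_lt_death p : birth p < death p.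
Proof. exact: (valP p). Qed.

(** Displacements and unmatched points have separate tolerances, because they
    behave differently under composition.  A relation makes the notion
    symmetric in the two diagrams. *)
Definition matches Y Y' c h : Prop :=
  exists r : dgm_index Y -> dgm_index Y' -> bool,
    [/\ forall i j j', r i j -> r i j' -> j = j',
        forall i i' j, r i j -> r i' j -> i = i',
        forall i j, r i j -> dinfty (dgm_point i) (dgm_point j) <= c,
        forall i, (exists j, r i j) \/ half_pers (dgm_point i) <= h &
        forall j, (exists i, r i j) \/ half_pers (dgm_point j) <= h].

Lemma dinfty_sym p q : dinfty p q = dinfty q p.
Proof. by rewrite /dinfty (distrC (birth p)) (distrC (death p)). Qed.

Lemma dinfty_leP p q c :
  dinfty p q <= c <-> `|birth p - birth q| <= c /\ `|death p - death q| <= c.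
Proof. by rewrite /dinfty ge_max; split=> [/andP//|[-> ->]]. Qed.

Lemma dinfty_triangle p q r c c' :
  dinfty p q <= c -> dinfty q r <= c' -> dinfty p r <= c + c'.
Proof.
move=> /dinfty_leP[b1 d1] /dinfty_leP[b2 d2]; apply/dinfty_leP; split.
  by rewrite -(subrKA (birth q)) (le_trans (ler_normD _ _))// lerD.
by rewrite -(subrKA (death q)) (le_trans (ler_normD _ _))// lerD.
Qed.

Lemma half_pers_le_dinfty p q c : dinfty p q <= c -> half_pers p <= half_pers q + c.
Proof.
by rewrite /half_pers => /dinfty_leP[]; rewrite !ler_norml; lra.
Qed.

Lemma matches_sym Y Y' c h : matches Y Y' c h -> matches Y' Y c h.
Proof.
move=> [r [r1 r2 rc rY rY']]; exists (fun j i => r i j); split=> //.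
- by move=> j i i'; exact: r2.
- by move=> j j' i; exact: r1.
- by move=> j i; rewrite dinfty_sym; exact: rc.
Qed.

Lemma matches_refl Y h : matches Y Y 0 h.
Proof.
exists (fun i j => i == j); split=> [i j j'|i i' j|i j|i|j].
- by move=> /eqP <- /eqP.
- by move=> /eqP -> /eqP ->.
- by move=> /eqP ->; rewrite /dinfty !subrr normr0 maxxx.
- by left; exists i.
- by left; exists j.
Qed.

(** A matched point loses at most its displacement in half-persistence; so a
    point that is matched by one matching and dropped by the other has
    half-persistence at most the tolerance of the second plus the displacement
    of the first.  The tolerances [h1] and [h2] are never added to each other, which
    lets arbitrarily many small errors be absorbed. *)
Lemma matches_comp Y2 Y1 Y3 c1 h1 c2 h2 h :
  matches Y1 Y2 c1 h1 -> matches Y2 Y3 c2 h2 ->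
  h1 <= h -> h2 <= h -> h1 + c2 <= h -> h2 + c1 <= h ->
  matches Y1 Y3 (c1 + c2) h.
Proof.
move=> [r [r1 r2 rc rY rY']] [s [s1 s2 sc sY sY']] h1h h2h h12 h21.
exists (fun i k => [exists j, r i j && s j k]); split.
- move=> i k k' /existsP[j /andP[ij jk]] /existsP[j' /andP[ij' jk']].
  by move: jk'; rewrite -(r1 _ _ _ ij ij'); exact: s1.
- move=> i i' k /existsP[j /andP[ij jk]] /existsP[j' /andP[ij' jk']].
  by move: ij'; rewrite -(s2 _ _ _ jk jk'); exact: r2.
- move=> i k /existsP[j /andP[ij jk]].
  exact: dinfty_triangle (rc _ _ ij) (sc _ _ jk).
- move=> i; have [[j ij]|] := rY i; last by right; lra.
  have [[k jk]|jh] := sY j.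
    by left; exists k; apply/existsP; exists j; rewrite ij.
  by right; have := half_pers_le_dinfty (rc _ _ ij); lra.
- move=> k; have [[j jk]|] := sY' k; last by right; lra.
  have [[i ij]|jh] := rY' j.
    by left; exists i; apply/existsP; exists j; rewrite ij.
  right; have := sc _ _ jk; rewrite dinfty_sym => /half_pers_le_dinfty; lra.
Qed.

Lemma bottleneck_le_matches Y Y' c h :
  0 <= h -> c <= h -> matches Y Y' c h -> bottleneck_dist Y Y' <= h.
Proof.
move=> h0 ch [r [r1 r2 rc rY rY']].
pose phi : partial_map Y Y' := [ffun i => [pick j | r i j]].
have phiE i j : (phi i == Some j) = r i j.
  rewrite ffunE; case: pickP => [j' ij'|no]; last by rewrite no.
  by apply/eqP/idP => [[<-]//|ij]; rewrite (r1 _ _ _ ij ij').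
have phi_match : is_matching phi.
  apply/dinjectiveP => i i'; rewrite !inE.
  case E: (phi i) => [j|//] _ _ /esym/eqP; rewrite phiE.
  by move/eqP: E; rewrite phiE; exact: r2.
rewrite /bottleneck_dist; apply: (@bigmin_inf _ R _ _ phi) phi_match _.
rewrite /matching_cost !ge_max; apply/and3P; split.
- apply: bigmax_le => // -[i j] /=; rewrite phiE => /rc; lra.
- apply: bigmax_le => // i /eqP iN.
  have [[j]|//] := rY i; by rewrite -phiE iN.
- apply: bigmax_le => // j jN; have [[i]|//] := rY' j.
  by rewrite -phiE => /eqP ij; rewrite -ij codom_f in jN.
Qed.

Lemma matches_bottleneck Y Y' :
  0 <= bottleneck_dist Y Y' /\
  matches Y Y' (bottleneck_dist Y Y') (bottleneck_dist Y Y').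
Proof.
have [phi phi_match ->] : exists2 phi : partial_map Y Y',
    is_matching phi & bottleneck_dist Y Y' = matching_cost phi.
  rewrite /bottleneck_dist; elim/big_ind : _ => [|x y|phi]; last by exists phi.
    by exists [ffun=> None] => //; apply/dinjectiveP => i i'; rewrite !inE ffunE.
  by move=> [a am ->] [b bm ->]; rewrite /Order.min; case: ifP; [exists a|exists b].
split; first by rewrite le_max; apply/orP; left; exact: bigmax_ge_id.
exists (fun i j => phi i == Some j); split.
- by move=> i j j' /eqP -> /eqP[].
- move=> i i' j /eqP ij /eqP i'j; move/dinjectiveP: phi_match; apply;
    by rewrite ?inE ?ij ?i'j.
- move=> i j ij; rewrite le_max; apply/orP; left.
  exact: (@le_bigmax_cond _ _ _ _ (i, j) _ (fun ij => dinfty (dgm_point ij.1) (dgm_point ij.2))).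
- move=> i; case E: (phi i) => [j|]; first by left; exists j.
  right; rewrite !le_max; apply/orP; right; apply/orP; left.
  exact/(@le_bigmax_cond _ _ _ _ i _ (fun i => half_pers (dgm_point i)))/eqP.
- move=> j; have [/codomP[i ->]|jN] := boolP (Some j \in codom phi).
    by left; exists i.
  right; rewrite !le_max; apply/orP; right; apply/orP; right.
  exact: (@le_bigmax_cond _ _ _ _ j _ (fun j => half_pers (dgm_point j))).
Qed.

End Matchings.

(** * Diagrams close in the erosion distance *)

Section FiberwiseBijection.

(** Matches, position by position, the enumeration of each fiber of [f] with the
    enumeration of the equinumerous set [Q (f i)]; disjointness of these sets
    makes the union of the partial bijections injective. *)
Lemma fiberwise_bijection (I J : finType) (T : eqType) (f : I -> T) (Q : T -> pred J) :
    (forall i i' j, Q (f i) j -> Q (f i') j -> f i = f i') ->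
    (forall i, #|[pred i' | f i' == f i]| = #|Q (f i)|) ->
  exists r : I -> J -> bool,
    [/\ forall i j j', r i j -> r i j' -> j = j',
        forall i i' j, r i j -> r i' j -> i = i',
        forall i j, r i j -> Q (f i) j,
        forall i, exists j, r i j &
        forall i j, Q (f i) j -> exists i', r i' j].
Proof.
move=> Qdisj Qcard; pose fib i := enum [pred i' | f i' == f i].
pose r i j := (j \in Q (f i)) && (index i (fib i) == index j (enum (Q (f i)))).
have fibi i : i \in fib i by rewrite mem_enum inE.
have size_fib i : size (fib i) = size (enum (Q (f i))) by rewrite -!cardE Qcard.
exists r; split.
- move=> i j j' /andP[ij /eqP e] /andP[ij' /eqP e'].
  by apply: (@index_inj _ j (enum (Q (f i)))); rewrite ?mem_enum// -e -e'.
- move=> i i' j /andP[ij /eqP e] /andP[i'j /eqP e'].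
  have ff := Qdisj _ _ _ ij i'j.
  have fibE : fib i' = fib i by apply: eq_enum => k; rewrite !inE ff.
  apply: (@index_inj _ i (fib i)); rewrite ?fibi// -?fibE ?fibi//.
  by rewrite e' fibE e ff.
- by move=> i j /andP[].
- move=> i; have : index i (fib i) < size (enum (Q (f i))) by rewrite -size_fib index_mem.
  case E : (enum (Q (f i))) => [//|j0 s]; rewrite -E => lt.
  exists (nth j0 (enum (Q (f i))) (index i (fib i))); rewrite /r index_uniq ?enum_uniq// eqxx andbT.
  by rewrite -mem_enum mem_nth.
- move=> i j ij; have : index j (enum (Q (f i))) < size (fib i).
    by rewrite size_fib index_mem mem_enum.
  move=> lt; set i' := nth i (fib i) (index j (enum (Q (f i)))); exists i'.
  have : i' \in fib i by rewrite mem_nth.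
  rewrite mem_enum inE => /eqP ff.
  have fibE : fib i' = fib i by apply: eq_enum => k; rewrite !inE ff.
  by rewrite /r ff fibE index_uniq ?enum_uniq// eqxx andbT.
Qed.

End FiberwiseBijection.

Section LocalMatching.
Local Open Scope classical_set_scope.
Local Open Scope ring_scope.
Variable R : realType.
Implicit Types (Y : PDgm R) (p q : half_plane R) (b d e c h x y : R) (s : seq R).

Lemma gap_above s x : exists2 g, 0 < g & forall y, y \in s -> x < y -> x + g <= y.
Proof.
exists (\big[Num.min/1]_(y <- s | x < y) (y - x)).
  by elim/big_ind : _ => [//|a b a0 b0|y]; rewrite ?lt_min ?a0 ?subr_gt0.
by move=> y ys xy; rewrite addrC -lerBrDr; exact: ge_bigmin_seq.
Qed.

Definition separated s (g : R) := forall x y, x \in s -> y \in s -> x < y -> x + g <= y.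

Lemma separated_exists s : exists2 g, 0 < g & separated s g.
Proof.
have [g g0 H] := gap_above [seq y - x | x <- s, y <- s] 0.
exists g => // x y xs ys xy.
rewrite addrC -lerBrDr -[g]add0r; apply: H; last by rewrite subr_gt0.
by apply/allpairsP; exists (x, y).
Qed.

Definition births Y := [seq birth p | p <- points Y].
Definition deaths Y := [seq death p | p <- points Y].

(** Moving a threshold by [e] from [x] does not cross any value of [s].  The
    half-open form fits both coordinates, since ranks test [birth p <= b] and
    [d < death p]. *)
Definition quiet s e x := forall z, z \in s -> ~~ (x - e < z <= x + e).

(** The two erosion inequalities squeeze the rank of [Y'] between two ranks of
    [Y] that are equal when the corner is quiet. *)
Lemma rank_quiet Y Y' e x y : eroded Y Y' e ->
  quiet (births Y) e x -> quiet (deaths Y) e y -> x + e <= y - e ->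
  rank Y' x y = rank Y x y.
Proof.
move=> [e0 He] qx qy xy; apply/eqP; rewrite eqn_leq; apply/andP; split.
  have [_] := He _ _ xy; rewrite addrK subrK => /leq_trans; apply.
  rewrite leq_eqVlt; apply/orP; left; apply/eqP; apply: eq_in_count => p pY /=.
  by have := qx _ (map_f _ pY); have := qy _ (map_f _ pY); lra.
have xy' : x <= y by lra.
have [+ _] := He _ _ xy'; apply: leq_trans.
rewrite leq_eqVlt; apply/orP; left; apply/eqP; apply: eq_in_count => p pY /=.
by have := qx _ (map_f _ pY); have := qy _ (map_f _ pY); lra.
Qed.

Definition in_box x0 x1 y0 y1 p := (x0 < birth p <= x1) && (y0 < death p <= y1).

(** Inclusion-exclusion, with the negative terms moved to the other side. *)
Lemma count_in_box Y x0 x1 y0 y1 : x0 <= x1 -> y0 <= y1 ->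
  (count (in_box x0 x1 y0 y1) (points Y) + rank Y x0 y0 + rank Y x1 y1 =
   rank Y x1 y0 + rank Y x0 y1)%N.
Proof.
move=> x01 y01; rewrite /rank; elim: (points Y) => [//|p s /=].
set a := count _ s; set b := count _ s; set c := count _ s.
set d := count _ s; set f := count _ s => IH.
have add (u v w z t : bool) : (u + v + w = z + t)%N ->
    (u + a + (v + b) + (w + c) = z + d + (t + f))%N.
  by move=> uv; rewrite (addnACA u) (addnACA (u + v)%N) uv IH addnACA.
apply: add; rewrite /in_box; clear a b c d f IH.
have [] := leP (birth p) x0; have [] := leP (birth p) x1;
  have [] := ltP y0 (death p); have [] := ltP y1 (death p) => //=; move=> *; exfalso; lra.
Qed.

Lemma count_in_box_quiet Y Y' e x0 x1 y0 y1 : eroded Y Y' e ->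
  quiet (births Y) e x0 -> quiet (births Y) e x1 ->
  quiet (deaths Y) e y0 -> quiet (deaths Y) e y1 ->
  x0 <= x1 -> y0 <= y1 -> x1 + e <= y0 - e ->
  count (in_box x0 x1 y0 y1) (points Y') = count (in_box x0 x1 y0 y1) (points Y).
Proof.
move=> He qx0 qx1 qy0 qy1 x01 y01 xy.
have := count_in_box Y x01 y01; have := count_in_box Y' x01 y01.
rewrite !(rank_quiet He) //; [|lra..].
by move=> <- /eqP; rewrite !eqn_add2r => /eqP.
Qed.

(** The lower end of the box needs [e < c] strictly: at distance exactly [e]
    below [b], the half-open test would see [b] itself. *)
Lemma quiet_at s g b e c : separated s g -> b \in s ->
  0 <= e -> e < c -> c + e <= g ->
  [/\ quiet s e (b - c), quiet s e (b + e) &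
      forall z, z \in s -> b - c < z <= b + e -> z = b].
Proof.
move=> sg bs e0 ec ceg; split=> z zs; have zb := sg _ _ zs bs; have bz := sg _ _ bs zs.
- have [/zb|/bz|->] := ltgtP z b; lra.
- have [/zb|/bz|->] := ltgtP z b; lra.
- have [/zb|/bz|->//] := ltgtP z b; lra.
Qed.

(** If no value of [s] is near [x], the interval ends at [x] itself and is so
    short that it contains no value of [s]; otherwise it is the tight interval
    of [quiet_at] around the value near [x]. *)
Lemma quiet_around s g x e c : separated s g -> 0 <= e -> e < c -> c + e <= g ->
  exists x0 x1, [/\ quiet s e x0, quiet s e x1, x0 < x <= x1,
    x - 2 * c <= x0 /\ x1 <= x + 2 * c &
    forall z, z \in s -> x0 < z <= x1 -> x0 = z - c /\ x1 = z + e].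
Proof.
move=> sg e0 ec ceg.
have [[b bs xb]|no] := pselect (exists2 b, b \in s & b - c < x <= b + e).
  have [q0 q1 uniq_b] := quiet_at sg bs e0 ec ceg.
  exists (b - c), (b + e); split=> //; first by lra.
  by move=> z zs /(uniq_b _ zs) ->.
have [t t0 Ht] := gap_above [seq - z | z <- s] (e - x).
have {}Ht z : z \in s -> z < x - e -> z <= x - e - t.
  by move=> zs zx; have := Ht _ (map_f _ zs); lra.
pose w := Num.min t c.
have w0 : 0 < w by rewrite lt_min t0; lra.
have wt : w <= t by rewrite ge_min lexx.
have wc : w <= c by rewrite ge_min lexx orbT.
have nos z : z \in s -> z <= x - e - t \/ x + c <= z.
  move=> zs; have [/(Ht _ zs)|xz] := ltP z (x - e); first by left.
  right; rewrite leNgt; apply/negP => zx; apply: no; exists z => //; lra.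
exists (x - w), x; split; [| |lra|lra|] => z zs; have [] := nos z zs; lra.
Qed.

Lemma card_dgm_point Y (P : pred (half_plane R)) :
  #|[pred i : dgm_index Y | P (dgm_point i)]| = count P (points Y).
Proof. by rewrite -sum1_card -sum1_count [RHS]big_tnth. Qed.

Lemma dgm_point_in Y (i : dgm_index Y) : dgm_point i \in points Y.
Proof. exact: mem_tnth. Qed.

Definition value_box e c p :=
  in_box (birth p - c) (birth p + e) (death p - c) (death p + e).

(** The matching is [fiberwise_bijection] for the tight boxes around the points
    of [Y].  A point [q] of [Y'] of large persistence lies in a box with quiet
    corners; such a box contains as many points of [Y] as of [Y'], hence some
    point [p] of [Y], and then it is the tight box around [p]. *)
Lemma eroded_matches Y Y' g h e c :
  separated (births Y ++ deaths Y) g -> eroded Y Y' e -> e < c ->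
  4 * c <= g -> 3 * c <= h -> matches Y Y' c h.
Proof.
move=> sg He ec cg ch; have e0 : 0 <= e by case: He.
have ceg : c + e <= g by lra.
have sb : separated (births Y) g.
  by move=> x y xs ys; apply: sg; rewrite mem_cat ?xs ?ys.
have sd : separated (deaths Y) g.
  by move=> x y xs ys; apply: sg; rewrite mem_cat ?xs ?ys orbT.
have bY p : p \in points Y -> birth p \in births Y by exact: map_f.
have dY p : p \in points Y -> death p \in deaths Y by exact: map_f.
have persY p : p \in points Y -> birth p + g <= death p.
  move=> pY; apply: sg (birth_lt_death p); rewrite mem_cat.
    by rewrite bY.
  by rewrite dY ?orbT.
have boxY p q : p \in points Y -> q \in points Y -> value_box e c p q = (q == p).
  move=> pY qY; have [_ _ ub] := quiet_at sb (bY _ pY) e0 ec ceg.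
  have [_ _ ud] := quiet_at sd (dY _ pY) e0 ec ceg.
  apply/andP/eqP => [[/(ub _ (bY _ qY)) b /(ud _ (dY _ qY)) d]|->]; last by lra.
  apply: val_inj; move: b d; rewrite /birth /death.
  by case: (val q) (val p) => [? ?] [? ?] /= -> ->.
have box_dinfty p q : value_box e c p q -> dinfty p q <= c.
  by move=> /andP[? ?]; apply/dinfty_leP; rewrite !ler_norml; lra.
have [||r [r1 r2 rQ rI rJ]] := @fiberwise_bijection (dgm_index Y) (dgm_index Y') _
  (@dgm_point R Y) (fun p => [pred j | value_box e c p (dgm_point j)]).
- move=> i i' j /= /andP[bi di] /andP[bi' di'].
  set p := dgm_point i in bi di *; set p' := dgm_point i' in bi' di' *.
  have pY : p \in points Y by exact: dgm_point_in.
  have p'Y : p' \in points Y by exact: dgm_point_in.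
  have b1 := sb _ _ (bY _ pY) (bY _ p'Y); have b2 := sb _ _ (bY _ p'Y) (bY _ pY).
  have d1 := sd _ _ (dY _ pY) (dY _ p'Y); have d2 := sd _ _ (dY _ p'Y) (dY _ pY).
  apply/esym/eqP; rewrite -boxY//; apply/andP; split.
    by have [/b1|/b2|->] := ltgtP (birth p) (birth p'); lra.
  by have [/d1|/d2|->] := ltgtP (death p) (death p'); lra.
- move=> i; have pY := dgm_point_in i; set p := dgm_point i in pY *.
  have [qb0 qb1 _] := quiet_at sb (bY _ pY) e0 ec ceg.
  have [qd0 qd1 _] := quiet_at sd (dY _ pY) e0 ec ceg.
  rewrite (card_dgm_point Y' (value_box e c p)) (card_dgm_point Y (pred1 p)).
  rewrite (count_in_box_quiet He)//; [|lra|lra|have := persY _ pY; lra].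
  by apply: eq_in_count => q qY; exact/esym/boxY.
exists r; split=> //.
- by move=> i j /rQ; exact: box_dinfty.
- by move=> i; left; exact: rI.
- move=> j; set q := dgm_point j; have [qh|hq] := leP (half_pers q) h; first by right.
  left; have [x0 [x1 [qx0 qx1 x01 [xc0 xc1] Hx]]] := quiet_around (birth q) sb e0 ec ceg.
  have [y0 [y1 [qy0 qy1 y01 [yc0 yc1] Hy]]] := quiet_around (death q) sd e0 ec ceg.
  have : has (in_box x0 x1 y0 y1) (points Y').
    by apply/hasP; exists q; [exact: dgm_point_in|rewrite /in_box x01 y01].
  rewrite /half_pers in hq; rewrite has_count (count_in_box_quiet He)//; [|lra..].
  rewrite -has_count => /hasP[p pY /andP[px py]].
  have [x0E x1E] := Hx _ (bY _ pY) px; have [y0E y1E] := Hy _ (dY _ pY) py.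
  have /tnthP[i iE] : p \in in_tuple (points Y) by [].
  apply: (rJ i); rewrite /= /dgm_point -iE.
  by rewrite /value_box /in_box -x0E -x1E -y0E -y1E x01 y01.
Qed.

(** The bound is exactly the erosion distance [m], although it is an infimum
    that need not be attained: the displacements take finitely many values, so
    a matching with displacements at most [m + w], with [w] small, has
    displacements at most [m]. *)
Lemma erosion_local_matches Y h : 0 < h -> exists2 r, 0 < r &
  forall Y', erosion_dist Y Y' < r -> matches Y Y' (erosion_dist Y Y') h.
Proof.
move=> h0; have [g g0 sg] := separated_exists (births Y ++ deaths Y).
pose r := Num.min (g / 4) (h / 3).
have rg : r <= g / 4 by rewrite ge_min lexx.
have rh : r <= h / 3 by rewrite ge_min lexx orbT.
exists r; first by rewrite lt_min !divr_gt0.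
move=> Y'; set m := erosion_dist Y Y' => mr.
pose ds := [seq dinfty p q | p <- points Y, q <- points Y'].
have [t t0 Ht] := gap_above ds m.
pose w := Num.min t (r - m) / 2.
have w0 : 0 < w by rewrite divr_gt0// lt_min t0 subr_gt0.
have wt : w < t.
  have : Num.min t (r - m) <= t by rewrite ge_min lexx.
  by rewrite /w; lra.
have wr : w <= r - m.
  have : Num.min t (r - m) <= r - m by rewrite ge_min lexx orbT.
  by rewrite /w; lra.
have [e He ew] := inf_adherent w0 (eroded_has_inf Y Y').
rewrite -/(erosion_dist Y Y') -/m in ew.
have [||f [f1 f2 fc fY fY']] := @eroded_matches Y Y' g h e (m + w) sg He ew; [lra|lra|].
exists f; split=> // i j /fc ij; rewrite leNgt; apply/negP => mij.
have : dinfty (dgm_point i) (dgm_point j) \in ds.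
  by apply/allpairsP; exists (dgm_point i, dgm_point j); rewrite !dgm_point_in.
by move=> /Ht/(_ mij); lra.
Qed.

End LocalMatching.

(** * From paths to matchings *)

Section PolygonalLength.
Local Open Scope classical_set_scope.
Local Open Scope ring_scope.
Variables (R : realType) (X : metricType R).
Implicit Types (f : R -> X) (s : seq R) (t K : R).

Lemma polygonal_length_rcons f s t :
  polygonal_length f (rcons s t) = polygonal_length f s + mdist (f (last 0 s)) (f t).
Proof.
rewrite /polygonal_length size_rcons big_nat_recr //=; congr (_ + _).
  apply: eq_big_nat => i /andP[_ si].
  by rewrite -rcons_cons !nth_rcons /= ltnS (ltnW si) si.
rewrite -rcons_cons !nth_rcons /= ltnS leqnn ltnn eqxx.
by rewrite -(last_nth 1 0 s).
Qed.

Lemma polygonal_length_ge0 f s : 0 <= polygonal_length f s.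
Proof. by apply: sumr_ge0 => i _; exact: mdist_ge0. Qed.

Lemma polygonal_length_lipschitz f s K :
  (forall t u, mdist (f t) (f u) <= K * `|t - u|) -> itv_partition 0 1 s ->
  polygonal_length f s <= K.
Proof.
move=> fK [s_incr /eqP s1]; suff : polygonal_length f s <= K * last 0 s by rewrite s1 mulr1.
elim/last_ind: s s_incr {s1} => [|s t IH]; first by rewrite /polygonal_length big_geq ?mulr0.
rewrite rcons_path polygonal_length_rcons last_rcons => /andP[/IH{}IH st].
have := fK (last 0 s) t; rewrite distrC gtr0_norm ?subr_gt0// mulrBr; lra.
Qed.

Lemma lipschitz_within_continuous (A : set R) f K :
  (forall t u, mdist (f t) (f u) <= K * `|t - u|) -> {within A, continuous f}.
Proof.
move=> fK; apply/subspace_continuousP => t _.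
apply: cvg_trans; first by apply: cvg_app; exact: cvg_within.
apply/metricType_numDomainType.cvgrPdist_lt => e e0.
have K1 : 0 < `|K| + 1 by rewrite ltr_wpDl.
apply/(@nbhs_normP R R); exists (e / (`|K| + 1)) => /= [|u tu]; first by rewrite divr_gt0.
rewrite /ball_/= ltr_pdivlMr// in tu; apply: le_lt_trans (fK t u) _; apply: le_lt_trans tu.
by rewrite mulrC ler_wpM2l// ler_wpDr// ler_norm.
Qed.

End PolygonalLength.

Section LowerBound.
Local Open Scope classical_set_scope.
Local Open Scope ring_scope.
Variable R : realType.
Implicit Types (Y : PDgm R) (h t : R).

Lemma path_local_matches (f : R -> erosion_space R) h t :
  {within `[0, 1], continuous f} -> 0 <= t <= 1 -> 0 < h ->
  exists2 e, 0 < e & forall u, 0 <= u <= 1 -> `|t - u| < e ->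
    matches (f t) (f u) (mdist (f t) (f u)) h.
Proof.
move=> /subspace_continuousP fc t01 h0.
have [r r0 Hr] := erosion_local_matches (f t) h0.
have : `[0, 1]%classic t by rewrite /= in_itv.
move=> /fc /metricType_numDomainType.cvgrPdist_lt /(_ _ r0).
move=> /(@nbhs_normP R R) [e /= e0 He]; exists e => // u u01 tu.
by apply: Hr; apply: (He u) => //; rewrite /= in_itv.
Qed.

(** The times up to which a partition and a matching exist form a set whose
    supremum [tau] belongs to it and is not below 1: local matchings centered
    at [f tau], backwards and forwards, extend any such matching across
    [tau].  Only matchings centered at one point of the path are used, so no
    uniformity along the path is required. *)
Lemma path_matches (f : R -> erosion_space R) h :
  {within `[0, 1], continuous f} -> 0 < h ->
  exists2 s, itv_partition 0 1 s &
    matches (f 0) (f 1) (polygonal_length f s) (polygonal_length f s + h).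
Proof.
move=> fc h0.
pose T := [set t : R | 0 <= t <= 1 /\ exists2 s, itv_partition 0 t s &
    matches (f 0) (f t) (polygonal_length f s) (polygonal_length f s + h)].
suff : T 1 by move=> [].
have step t u : T t -> t < u <= 1 ->
    matches (f t) (f u) (mdist (f t) (f u)) h -> T u.
  move=> [t01 [s [s_incr /eqP st] Ms]] tu Mtu; split; first by lra.
  exists (rcons s u).
    by split; rewrite ?last_rcons// rcons_path s_incr st; lra.
  have := polygonal_length_ge0 f s.
  have := mdist_ge0 (f t) (f u).
  rewrite polygonal_length_rcons st => d0 s0.
  by apply: (matches_comp Ms Mtu); lra.
have T0 : T 0.
  split; first by lra.
  exists [::]; first by split=> /=.
  by rewrite /polygonal_length big_geq//; exact: matches_refl.
have supT : has_sup T by split; [exists 0|exists 1 => t [/andP[]]].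
pose tau := sup T.
have Ttau t : T t -> t <= tau by move=> Tt; exact: sup_upper_bound.
have tau01 : 0 <= tau <= 1.
  by rewrite Ttau//=; apply: ge_sup; [exists 0|move=> t [/andP[]]].
have [e e0 He] := path_local_matches fc tau01 h0.
have {}Ttau_mem : T tau.
  have [t Tt et] := sup_adherent e0 supT; rewrite -/tau in et.
  have := Ttau _ Tt; rewrite le_eqVlt => /orP[/eqP <-//|tlt].
  have [t01 _] := Tt.
  apply: (step t) => //; first by lra.
  rewrite [mdist _ _]erosion_dist_sym; apply: matches_sym; apply: He => //.
  by rewrite gtr0_norm; lra.
have [tau1|tau1] := ltP tau 1; last by rewrite (_ : 1 = tau)//; lra.
pose u := Num.min 1 (tau + e / 2).
have u1 : u <= 1 by rewrite ge_min lexx.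
have ue : u <= tau + e / 2 by rewrite ge_min lexx orbT.
have tu : tau < u by rewrite lt_min tau1; lra.
have /Ttau : T u; last by lra.
apply: (step tau) => //; first by lra.
by apply: He; [lra|rewrite distrC gtr0_norm; lra].
Qed.

Lemma bottleneck_le_path_length Y Y' (f : R -> erosion_space R) :
  {within `[0, 1], continuous f} -> f 0 = Y -> f 1 = Y' ->
  ((bottleneck_dist Y Y')%:E <= path_length f)%E.
Proof.
move=> fc f0 f1; apply/lee_addgt0Pr => h h0.
have [s s01 M] := path_matches fc h0.
rewrite f0 f1 in M; have s0 := polygonal_length_ge0 f s.
apply: (@le_trans _ _ (polygonal_length f s + h)%:E).
  by rewrite lee_fin; apply: bottleneck_le_matches M; lra.
by rewrite EFinD leeD2r//; apply: ereal_sup_ubound; exists s.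
Qed.

End LowerBound.

(** * From matchings to paths *)

Section StraightLinePath.
Local Open Scope classical_set_scope.
Local Open Scope ring_scope.
Variable R : realType.
Implicit Types (Y : PDgm R) (p q : half_plane R) (b d t u K : R).
Implicit Types (z : R * R) (e : (R * R) * (R * R)).

Lemma eq_rank_dgm Y Y' : (forall b d, b <= d -> rank Y b d = rank Y' b d) -> Y = Y'.
Proof.
move=> rankE; apply: erosion_dist_eq0; apply/eqP.
rewrite eq_le erosion_dist_ge0 andbT; apply: ge_inf; first by exists 0 => e [].
by split=> // b d bd; rewrite subr0 addr0 rankE.
Qed.

(** Pairs on or below the diagonal are discarded; they do not contribute to
    ranks at [b <= d], so this is harmless in [rank_dgm_of]. *)
Definition dgm_of (s : seq (R * R)) : PDgm R := seq_mset (pmap insub s).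

Definition quadrant b d z := (z.1 <= b) && (d < z.2).

Lemma rank_dgm_of s b d : b <= d -> rank (dgm_of s) b d = count (quadrant b d) s.
Proof.
move=> bd; rewrite /rank /dgm_of /points (permP (perm_eq_seq_mset _)).
elim: s => //= z s IH; case: insubP => [p _ pz|zN] /=; rewrite IH.
  by rewrite /birth /death pz.
suff /negbTE -> : ~~ quadrant b d z by [].
by apply: contra zN => /andP[zb dz]; lra.
Qed.

Definition lerp t e : R * R :=
  ((1 - t) * e.1.1 + t * e.2.1, (1 - t) * e.1.2 + t * e.2.2).

Lemma lerp0 e : lerp 0 e = e.1.
Proof. by case: e => -[? ?] [? ?]; rewrite /lerp subr0 !mul1r !mul0r !addr0. Qed.

Lemma lerp1 e : lerp 1 e = e.2.
Proof. by case: e => -[? ?] [? ?]; rewrite /lerp subrr !mul1r !mul0r !add0r. Qed.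

Definition lerp_path (E : seq ((R * R) * (R * R))) t : PDgm R :=
  dgm_of [seq lerp t e | e <- E].

(** Between times [t] and [u] every point moves by at most [K * `|t - u|] in
    both coordinates, hence a point counted in the eroded quadrant at one time
    is counted in the quadrant at the other. *)
Lemma erosion_dist_lerp_path (E : seq ((R * R) * (R * R))) K t u :
  (forall e, e \in E -> `|e.1.1 - e.2.1| <= K /\ `|e.1.2 - e.2.2| <= K) -> 0 <= K ->
  erosion_dist (lerp_path E t) (lerp_path E u) <= K * `|t - u|.
Proof.
move=> EK K0; apply: ge_inf; first by exists 0 => x [].
have Ktu : 0 <= K * `|t - u| by rewrite mulr_ge0.
have speed (v w x y : R) : `|x - y| <= K ->
    `|((1 - v) * x + v * y) - ((1 - w) * x + w * y)| <= K * `|v - w|.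
  move=> xyK; rewrite (_ : _ - _ = (x - y) * (w - v)); last by ring.
  by rewrite normrM (distrC w) ler_wpM2r.
have shrink (v w b d : R) : b <= d -> (rank (lerp_path E v) (b - K * `|v - w|)%R
    (d + K * `|v - w|)%R <= rank (lerp_path E w) b d)%N.
  move=> bd; have Kvw : 0 <= K * `|v - w| by rewrite mulr_ge0.
  rewrite !rank_dgm_of//; last by lra.
  rewrite !count_map; elim: E EK => //= e E IH EK.
  apply: leq_add; last by apply: IH => e' e'E; apply: EK; rewrite inE e'E orbT.
  have [/(speed v w) + /(speed v w)] := EK e (mem_head _ _).
  rewrite !ler_norml /quadrant/=.
  set x := K * _ in Kvw *.
  move=> /andP[h1 h2] /andP[h3 h4].
  by case: andP => // -[h5 h6]; rewrite lt0b; apply/andP; split; lra.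
split=> // b d bd; split; first exact: shrink.
by rewrite distrC; exact: shrink.
Qed.

(** Each index is either in exactly one matched pair or unmatched.  It shows
    that the segments of a matching start at [Y], and, transposed, that they
    end at [Y']. *)
Lemma sum_matched_unmatched (I J : finType) (r : I -> J -> bool) (a : I -> nat) :
  (forall i j j', r i j -> r i j' -> j = j') ->
  (\sum_i \sum_(j | r i j) a i + \sum_(i | ~~ [exists j, r i j]) a i = \sum_i a i)%N.
Proof.
move=> r1; rewrite [X in (_ + X)%N]big_mkcond -big_split /=.
apply: eq_bigr => i _; have [/existsP[j ij]|/existsPn no] := boolP [exists j, r i j].
  rewrite (big_pred1 j) ?addn0// => j'; apply/idP/eqP => [ij'|->//].
  exact: r1 ij' ij.
by rewrite big_pred0// => j; apply/negbTE.
Qed.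

Lemma count_enum (T : finType) (A P : pred T) :
  count P (enum A) = (\sum_(x | A x) P x)%N.
Proof. by rewrite -sum1_count big_enum_cond big_mkcondr /=; apply: eq_bigr => x _; case: (P x). Qed.

Lemma rankE Y b d : rank Y b d = (\sum_(i : dgm_index Y) quadrant b d (val (dgm_point i)))%N.
Proof.
rewrite /rank -(card_dgm_point Y) -sum1_card big_mkcond /=.
by apply: eq_bigr => i _; rewrite inE /quadrant; case: ifP.
Qed.

Definition midpoint p : R * R := ((birth p + death p) / 2, (birth p + death p) / 2).

Lemma quadrant_midpoint b d p : b <= d -> quadrant b d (midpoint p) = false.
Proof. by move=> bd; apply/negbTE/negP => /andP[/= ? ?]; lra. Qed.

Definition matching_segments Y Y' (r : dgm_index Y -> dgm_index Y' -> bool) :=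
  [seq (val (dgm_point ij.1), val (dgm_point ij.2)) | ij <- enum [pred ij | r ij.1 ij.2]]
  ++ [seq (val (dgm_point i), midpoint (dgm_point i)) | i <- enum [pred i | ~~ [exists j, r i j]]]
  ++ [seq (midpoint (dgm_point j), val (dgm_point j)) | j <- enum [pred j | ~~ [exists i, r i j]]].

(** The path is identified with [Y] and [Y'] at its ends by comparing ranks,
    where the midpoints on the diagonal count for nothing. *)
Lemma matches_lerp_path Y Y' K : 0 <= K -> matches Y Y' K K ->
  exists f : R -> erosion_space R,
    [/\ f 0 = Y, f 1 = Y' & forall t u, mdist (f t) (f u) <= K * `|t - u|].
Proof.
move=> K0 [r [r1 r2 rK rY rY']]; exists (lerp_path (matching_segments r)); split.
- apply: eq_rank_dgm => b d bd.
  rewrite rank_dgm_of// /matching_segments !map_cat !count_cat -!map_comp !count_map !count_enum.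
  rewrite rankE -(sum_matched_unmatched _ r1) pair_big_dep /= addnA.
  rewrite [X in (_ + X)%N]big1 ?addn0 => [|j _]; last first.
    by rewrite /= lerp0 quadrant_midpoint.
  by congr (_ + _)%N; apply: eq_bigr => i _; rewrite /= lerp0.
- apply: eq_rank_dgm => b d bd.
  rewrite rank_dgm_of// /matching_segments !map_cat !count_cat -!map_comp !count_map !count_enum.
  rewrite rankE -(@sum_matched_unmatched _ _ (fun j i => r i j)); last first.
    by move=> j i i'; exact: r2.
  rewrite (exchange_big_dep xpredT)//= pair_big_dep /=.
  rewrite addnCA [X in (X + _)%N]big1 ?add0n => [|i _]; last first.
    by rewrite /= lerp1 quadrant_midpoint.
  by congr (_ + _)%N; apply: eq_bigr => i _; rewrite /= lerp1.
- move=> t u; apply: erosion_dist_lerp_path => // e.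
  rewrite !mem_cat => /or3P[] /mapP[x]; rewrite mem_enum inE => rx -> /=.
  + by apply/dinfty_leP; exact: rK.
  + have [[j xj]|] := rY x; first by case/existsP: rx; exists j.
    have := birth_lt_death (dgm_point x).
    by rewrite /half_pers /birth /death !ler_norml; lra.
  + have [[i ix]|] := rY' x; first by case/existsP: rx; exists i.
    have := birth_lt_death (dgm_point x).
    by rewrite /half_pers /birth /death !ler_norml; lra.
Qed.

End StraightLinePath.

(** * The intrinsic erosion metric *)

Theorem theorem4p7 (R : realType) (Y Y' : PDgm R) :
  intrinsic_dist (erosion_space R) Y Y' = (bottleneck_dist Y Y')%:E.
Proof.
have [c0 M] := matches_bottleneck Y Y'.
have [f [f0 f1 fK]] := matches_lerp_path c0 M.
apply/eqP; rewrite eq_le; apply/andP; split.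
  apply: (@le_trans _ _ (path_length f)).
    apply: ereal_inf_lbound; exists f => //; split=> //.
    exact: lipschitz_within_continuous fK.
  apply: ge_ereal_sup => _ [s s01 <-]; rewrite lee_fin.
  exact: polygonal_length_lipschitz fK s01.
apply: le_ereal_inf_tmp => _ [g [gc g0 g1] <-].
exact: bottleneck_le_path_length gc g0 g1.
Qed.
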